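(* For every positive integer $n$, $$\sum_{k=1}^{n}\left\{k^{2}\ln k+2k\ln\Gamma(k+1)-2k\ln k-\ln\Gamma(k+1)+\ln k\right\}=n^{2}\ln\Gamma(n+1).$$
   Context: $\Gamma$ is the gamma function and $\ln$ is the natural logarithm. *)

(* Defs.v *)
From Stdlib Require Import Reals.
From Coquelicot Require Import Coquelicot.
Open Scope R_scope.

(* Euler's integral, convergent exactly for x > 0 and meaningful only there;
   improper at both ends.  [Rpower t (x - 1)] is only used for t > 0, where it
   is the real power. *)
Definition Gamma (x : R) : R :=
  RInt_gen (fun t : R => Rpower t (x - 1) * exp (- t))
    (at_right 0) (Rbar_locally p_infty).

(* Main.v *)
(** With [Gamma (k + 1) = k!] the summand equals
    [k^2 ln k! - (k - 1)^2 ln (k - 1)!], so the sum telescopes.  The value of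
    the improper integral comes from the antiderivative of [t^n e^(-t)] produced
    by repeated integration by parts. *)
Require Import Defs.
From Stdlib Require Import Reals Lra Lia.
From Stdlib Require Import ssreflect.
From Coquelicot Require Import Coquelicot.
Open Scope R_scope.

(** The constant of integration is chosen so that the primitive vanishes at infinity; the whole
    integral is then read off at [0]. *)
Fixpoint gamma_primitive (n : nat) (t : R) : R :=
  match n with
  | O => - exp (- t)
  | S m => - (t ^ S m * exp (- t)) + INR (S m) * gamma_primitive m t
  end.

Lemma is_derive_gamma_primitive (n : nat) (t : R) :
  is_derive (gamma_primitive n) t (t ^ n * exp (- t)).
Proof.
  induction n as [|n IH].
  - cbn [gamma_primitive]. auto_derive; [exact I | simpl; ring].
  - cbn [gamma_primitive].
    (* The first bracket is the derivative of the boundary term; its unwanted part cancels against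
       the recursive term. *)
    replace (t ^ S n * exp (- t)) with
      ((- (INR (S n) * t ^ n * exp (- t)) + t ^ S n * exp (- t))
       + INR (S n) * (t ^ n * exp (- t))) by ring.
    apply: is_derive_plus.
    + auto_derive; [exact I|].
      change (Nat.pred (S n)) with n.
      change (match n with O => 1 | S _ => INR n + 1 end) with (INR (S n)).
      rewrite S_INR. simpl. ring.
    + apply: is_derive_scal. exact IH.
Qed.

Lemma gamma_primitive_0 (n : nat) :
  gamma_primitive n 0 = - INR (Factorial.fact n).
Proof.
  induction n as [|n IH]; cbn [gamma_primitive].
  - rewrite Ropp_0 exp_0. simpl; ring.
  - rewrite IH fact_simpl mult_INR pow_i; [ring | lia].
Qed.

(** Squeeze for [t > 0]: a single term of the exponential series gives [exp t >= t ^ S n / (S n)!],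
    hence the upper bound [(S n)! / t]. *)
Lemma is_lim_pow_mul_exp_opp (n : nat) :
  is_lim (fun t => t ^ n * exp (- t)) p_infty 0.
Proof.
  apply (is_lim_le_le_loc (fun _ => 0)
           (fun t => INR (Factorial.fact (S n)) * / t)).
  - exists 0. intros t Ht.
    assert (He : exp (- t) > 0) by apply exp_pos.
    assert (Hp : 0 < t ^ n) by (apply pow_lt; lra).
    assert (Hf : 0 < INR (Factorial.fact (S n))) by apply INR_fact_lt_0.
    split; [nra|].
    assert (Hexp : t ^ S n / INR (Factorial.fact (S n)) <= exp t).
    { eapply Rle_trans; [|apply (exp_ge_taylor t (S n)); lra].
      (* Splits off the top Taylor term; the remaining ones are nonnegative. *)
      rewrite tech5.
      assert (0 <= sum_f_R0 (fun k => t ^ k / INR (Factorial.fact k)) n);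
        [|lra].
      apply cond_pos_sum. intros k.
      apply Rlt_le, Rdiv_lt_0_compat; [apply pow_lt; lra | apply INR_fact_lt_0]. }
    apply (Rmult_le_reg_r (t * exp t)).
    { apply Rmult_lt_0_compat; [lra | apply exp_pos]. }
    rewrite exp_Ropp.
    replace (t ^ n * / exp t * (t * exp t)) with (t ^ S n)
      by (simpl; field; apply Rgt_not_eq, exp_pos).
    replace (INR (Factorial.fact (S n)) * / t * (t * exp t))
      with (exp t * INR (Factorial.fact (S n))) by (field; lra).
    apply Rle_div_l; assumption.
  - apply is_lim_const.
  - replace (Finite 0) with (Rbar_mult (INR (Factorial.fact (S n))) (Rbar_inv p_infty))
      by (simpl; f_equal; ring).
    apply is_lim_scal_l, is_lim_inv; [apply is_lim_id | discriminate].
Qed.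

Lemma is_lim_gamma_primitive (n : nat) :
  is_lim (gamma_primitive n) p_infty 0.
Proof.
  induction n as [|n IH].
  - apply (is_lim_ext (fun t => - (t ^ 0 * exp (- t)))).
    { intros t. simpl. ring. }
    replace (Finite 0) with (Rbar_opp 0) by (simpl; f_equal; ring).
    apply is_lim_opp, is_lim_pow_mul_exp_opp.
  - cbn [gamma_primitive].
    replace (Finite 0) with (Finite (- 0 + INR (S n) * 0)) by (f_equal; ring).
    apply is_lim_plus'.
    + apply (is_lim_opp _ _ 0), is_lim_pow_mul_exp_opp.
    + apply (is_lim_scal_l _ _ _ 0), IH.
Qed.

(** Keeps the interval of integration inside [t > 0], where [Rpower] agrees with [pow]. *)
Lemma filter_prod_pos_le :
  filter_prod (at_right 0) (Rbar_locally p_infty)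
    (fun ab => 0 < fst ab /\ fst ab <= snd ab).
Proof.
  apply (Filter_prod _ _ _ (fun a => 0 < a < 1) (fun b => 1 < b)).
  - exists (mkposreal 1 Rlt_0_1). intros a Ha Ha0.
    apply Rabs_def2 in Ha. cbn in Ha. unfold minus, plus, opp in Ha. cbn in Ha.
    lra.
  - exists 1. auto.
  - cbn. intros a b Ha Hb. lra.
Qed.

Lemma Gamma_INR_plus_1 (n : nat) : Gamma (INR n + 1) = INR (Factorial.fact n).
Proof.
  apply is_RInt_gen_unique.
  assert (HD : forall t, Derive (gamma_primitive n) t = t ^ n * exp (- t)).
  { intros t. apply is_derive_unique, is_derive_gamma_primitive. }
  apply (is_RInt_gen_ext (Derive (gamma_primitive n))).
  { apply: filter_imp filter_prod_pos_le.
    intros [a b] [Ha Hab] x Hx. cbn in *.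
    rewrite (Rmin_left a b Hab) in Hx.
    rewrite HD. replace (INR n + 1 - 1) with (INR n) by ring.
    rewrite Rpower_pow; [reflexivity | lra]. }
  replace (INR (Factorial.fact n)) with (0 - gamma_primitive n 0)
    by (rewrite gamma_primitive_0; ring).
  apply is_RInt_gen_Derive.
  - apply filter_forall. intros ab x _. eexists.
    apply is_derive_gamma_primitive.
  - apply filter_forall. intros ab x _.
    apply (continuous_ext (fun t => t ^ n * exp (- t))).
    { intros t. symmetry. apply HD. }
    apply: ex_derive_continuous. auto_derive. exact I.
  (* The primitive is continuous at [0] from both sides, so its right limit there is its value. *)
  - apply: filterlim_filter_le_1; first exact: filter_le_within.
    apply: ex_derive_continuous. eexists. apply is_derive_gamma_primitive.
  - apply is_lim_gamma_primitive.
Qed.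

Theorem proposition4p1 (n : nat) (hn : (1 <= n)%nat) :
  sum_n_m (fun k : nat =>
      INR k ^ 2 * ln (INR k)
      + 2 * INR k * ln (Gamma (INR k + 1))
      - 2 * INR k * ln (INR k)
      - ln (Gamma (INR k + 1))
      + ln (INR k)) 1 n
  = INR n ^ 2 * ln (Gamma (INR n + 1)).
Proof.
  induction n as [|n IH]; [lia|].
  (* The sum starts at 1, so the true base case is [n = 1]. *)
  destruct n as [|n].
  - rewrite sum_n_n Gamma_INR_plus_1. simpl. rewrite ln_1. ring.
  - rewrite sum_n_Sm; [|lia]. rewrite IH; [|lia].
    rewrite !Gamma_INR_plus_1 (fact_simpl (S n)) mult_INR.
    rewrite ln_mult; [|apply lt_0_INR; lia | apply INR_fact_lt_0].
    (* With [m = INR (S n) + 1] and [L] the log of [(S n)!], the coefficient of [L] is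
       [(m - 1)^2 + 2m - 1 = m^2], and that of [ln m] is [m^2 + 2m - 2m - 1 + 1 = m^2]. *)
    rewrite (S_INR (S n)). unfold plus; cbn -[INR Factorial.fact ln pow]. ring.
Qed.
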